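(* Let $(A,B,P)$ be a tetrablock contraction on a Hilbert space $\mathcal{H}$ whose fundamental operators $F_1,F_2$ satisfy $[F_1,F_2]=0$ and $[F_1,F_1^*]=[F_2,F_2^*]$, and let $(R_1,R_2,U)$ be the explicit tetrablock unitary dilation of $(A,B,P)$ on $\mathcal{K}=\mathcal{H}\oplus l^2(\mathcal{D}_P)\oplus l^2(\mathcal{D}_{P^*})$ defined in the context. Then this dilation is minimal, that is, $$\mathcal{K}=\overline{\mathrm{span}}\{R_1^{k_1}R_2^{k_2}U^{k_3}R_1^{*l_1}R_2^{*l_2}U^{*l_3}h:\ h\in\mathcal{H},\ k_i,l_i\in\{0,1,2,\dots\}\text{ for }i=1,2,3\}.$$
   Context: All Hilbert spaces are complex. The tetrablock is the domain $E=\{(a_{11},a_{22},\det A): A=\begin{pmatrix}a_{11}&a_{12}\\ a_{21}&a_{22}\end{pmatrix},\ \|A\|<1\}\subset\mathbb{C}^3$. A triple $(A,B,P)$ of commuting bounded operators on a Hilbert space is a tetrablock contraction if its joint spectrum is contained in $\overline{E}$ and $\|f(A,B,P)\|\le\sup_{\overline{E}}|f|$ for every polynomial $f$ in three variables. Then $P$ is a contraction and $(A^*,B^*,P^* )$ is also a tetrablock contraction. For a contraction $P$ on $\mathcal{H}$: $D_P=(I-P^*P)^{1/2}$, $D_{P^*}=(I-PP^* )^{1/2}$, $\mathcal{D}_P=\overline{\mathrm{Ran}}\,D_P$, $\mathcal{D}_{P^*}=\overline{\mathrm{Ran}}\,D_{P^*}$. Fundamental operators of a tetrablock contraction $(A,B,P)$: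 the (known to exist and be unique) bounded operators $F_1,F_2$ on $\mathcal{D}_P$ with $A-B^*P=D_PF_1D_P$ and $B-A^*P=D_PF_2D_P$. Correspondingly, the fundamental operators $G_1,G_2\in\mathcal{B}(\mathcal{D}_{P^*})$ of $(A^*,B^*,P^* )$ satisfy $A^*-BP^*=D_{P^*}G_1D_{P^*}$ and $B^*-AP^*=D_{P^*}G_2D_{P^*}$. Notation: $[X,Y]=XY-YX$; $l^2(\mathcal{E})$ is the space of square-summable sequences $(a_0,a_1,\dots)$ in $\mathcal{E}$. The explicit dilation $(R_1,R_2,U)$ (a commuting triple of normal operators on $\mathcal{K}$): let $\tilde{\mathcal{H}}=\mathcal{H}\oplus l^2(\mathcal{D}_P)$ (with $\mathcal{H}$ identified with the first summand), $\mathcal{K}=\tilde{\mathcal{H}}\oplus l^2(\mathcal{D}_{P^*})$. Define on $\tilde{\mathcal{H}}$ $$V_1(h\oplus(a_0,a_1,\dots))=Ah\oplus(F_2^*D_Ph+F_1a_0,F_2^*a_0+F_1a_1,F_2^*a_1+F_1a_2,\dots),$$ $$V_2(h\oplus(a_0,a_1,\dots))=Bh\oplus(F_1^*D_Ph+F_2a_0,F_1^*a_0+F_2a_1,F_1^*a_1+F_2a_2,\dots),$$ $$V_3(h\oplus(a_0,a_1,\dots))=Ph\oplus(D_Ph,a_0,a_1,\dots);$$ define $C_1,C_2,C_3:l^2(\mathcal{D}_{P^*})\to\tilde{\mathcal{H}}$ by $$C_1(a_0,a_1,\dots)=D_{P^*}G_2a_0\oplus(-F_2^*P^*a_0,0,\dots),\quad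 C_2(a_0,a_1,\dots)=D_{P^*}G_1a_0\oplus(-F_1^*P^*a_0,0,\dots),$$ $$C_3(a_0,a_1,\dots)=D_{P^*}a_0\oplus(-P^*a_0,0,\dots);$$ and $D_1,D_2,D_3$ on $l^2(\mathcal{D}_{P^*})$ by $$D_1(a_0,a_1,\dots)=(G_1^*a_0+G_2a_1,G_1^*a_1+G_2a_2,\dots),\quad D_2(a_0,a_1,\dots)=(G_2^*a_0+G_1a_1,G_2^*a_1+G_1a_2,\dots),$$ $$D_3(a_0,a_1,\dots)=(a_1,a_2,\dots).$$ Then, with respect to $\mathcal{K}=\tilde{\mathcal{H}}\oplus l^2(\mathcal{D}_{P^*})$, $$R_1=\begin{pmatrix}V_1&C_1\\0&D_1\end{pmatrix},\quad R_2=\begin{pmatrix}V_2&C_2\\0&D_2\end{pmatrix},\quad U=\begin{pmatrix}V_3&C_3\\0&D_3\end{pmatrix}.$$ *)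

(* Defs.v *)
From HB Require Import structures.
From mathcomp Require Import all_boot all_order all_algebra.
From mathcomp Require Import complex.
From mathcomp Require Import ring.
From mathcomp Require mpoly.
From mathcomp Require Import all_classical all_reals topology normedtype sequences.
Set Implicit Arguments.
Unset Strict Implicit.
Unset Printing Implicit Defensive.
Import Order.TTheory GRing.Theory Num.Theory.
Import numFieldNormedType.Exports.
Local Open Scope classical_set_scope.
Local Open Scope ring_scope.

HB.instance Definition _ (R : realType) := NormedModule.copy R[i] (R[i])^o.

(** Complex Hilbert spaces; the inner product is linear in its first argument. *)

HB.mixin Record NormedModule_isPreHilbert (R : realType) H
    & NormedModule R[i] H := {
  inner : H -> H -> R[i];
  inner_linearl : forall z, scalar (inner^~ z);
  innerC : forall x y, inner x y = (inner y x)^*%R;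
  inner_norm : forall x, inner x x = `|x| ^+ 2
}.

#[short(type="preHilbertType")]
HB.structure Definition PreHilbert (R : realType) :=
  {H of NormedModule_isPreHilbert R H & NormedModule R[i] H}.

#[short(type="hilbertType")]
HB.structure Definition Hilbert (R : realType) :=
  {H of PreHilbert R H & Complete H}.

HB.factory Record Lmodule_isPreHilbert (R : realType) H
    & GRing.Lmodule R[i] H := {
  inner : H -> H -> R[i];
  inner_linearl : forall z, scalar (inner^~ z);
  innerC : forall x y, inner x y = (inner y x)^*%R;
  inner_ge0 : forall x, 0 <= inner x x;
  inner_eq0 : forall x, inner x x = 0 -> x = 0
}.

HB.builders Context R H & Lmodule_isPreHilbert R H.

Let innerDl x y z : inner (x + y) z = inner x z + inner y z.
Proof. by have := inner_linearl z 1 x y; rewrite !scale1r mul1r. Qed.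

Let inner0l z : inner 0 z = 0.
Proof. by apply: (addrI (inner 0 z)); rewrite -innerDl !addr0. Qed.

Let innerZl a x z : inner (a *: x) z = a * inner x z.
Proof. by have := inner_linearl z a x 0; rewrite inner0l !addr0. Qed.

Let innerDr x y z : inner z (x + y) = inner z x + inner z y.
Proof. by rewrite innerC innerDl rmorphD /= -!innerC. Qed.

Let innerZr a x z : inner z (a *: x) = a^* * inner z x.
Proof. by rewrite innerC innerZl rmorphM /= -innerC. Qed.

Let norm x : R[i] := sqrtC (inner x x).

Let norm_ge0 x : 0 <= norm x.
Proof. by rewrite sqrtC_ge0 inner_ge0. Qed.

Let CauchySchwarz x y : `|inner x y| <= norm x * norm y.
Proof.
have [y0|yn0] := eqVneq (inner y y) 0.
  have := inner_eq0 y0 => ->.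
  by rewrite innerC inner0l conjC0 normr0 mulr_ge0.
have yy0 : 0 < inner y y by rewrite lt_neqAle eq_sym yn0 inner_ge0.
rewrite -(@ler_pXn2r _ 2) ?nnegrE ?normr_ge0 ?mulr_ge0//.
rewrite exprMn !sqrtCK.
have := inner_ge0 (inner y y *: x + (- inner x y) *: y).
rewrite !(innerDl, innerDr, innerZl, innerZr) (innerC y x).
have -> : (inner y y)^* = inner y y by rewrite -innerC.
rewrite rmorphN /= normCK.
set a := inner x x; set b := inner y y; set z := inner x y.
have -> : b * (b * a) + b * (- z^* * z) + (- z * (b * z^*) + - z * (- z^* * b))
  = b * (a * b - z * z^*) by ring.
by rewrite pmulr_rge0// subr_ge0.
Qed.

Let ler_normD x y : norm (x + y) <= norm x + norm y.
Proof.
rewrite -(@ler_pXn2r _ 2) ?nnegrE ?addr_ge0//.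
rewrite sqrrD !sqrtCK !(innerDl, innerDr) (innerC y x).
have -> : inner x x + inner x y + ((inner x y)^* + inner y y) =
  inner x x + (inner x y + (inner x y)^*) + inner y y by rewrite !addrA.
rewrite lerD2r lerD2l.
have -> : inner x y + (inner x y)^* = 'Re (inner x y) *+ 2.
  by rewrite ReE -mulr_natr mulfVK// pnatr_eq0.
rewrite lerMn2r/=.
apply: le_trans (CauchySchwarz x y).
exact: (leif_Re_Creal (inner x y)).
Qed.

Let normrZ (l : R[i]) x : norm (l *: x) = `|l| * norm x.
Proof.
rewrite /norm innerZl innerZr mulrA -normCK rootCMl ?exprn_ge0//.
by rewrite sqrCK.
Qed.

Let normr0_eq0 x : norm x = 0 -> x = 0.
Proof.
by move=> /eqP; rewrite sqrtC_eq0 => /eqP /inner_eq0.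
Qed.

HB.instance Definition _ :=
  Lmodule_isNormed.Build R[i] H ler_normD normrZ normr0_eq0.

Let inner_norm x : inner x x = `|x| ^+ 2.
Proof. by rewrite sqrtCK. Qed.

HB.instance Definition _ :=
  NormedModule_isPreHilbert.Build R H inner_linearl innerC inner_norm.

HB.end.
Definition rnorm (R : realType) (V : normedModType R[i]) (x : V) : R :=
  complex.Re `|x|.

(** Bounded operators are the continuous linear maps. *)
#[short(type="boundedOp")]
HB.structure Definition BoundedOp (K : numDomainType) (V W : normedModType K) :=
  {f of @isContinuous V W f & @GRing.Linear K V W *:%R f}.

Section op_facts.
Context (R : realType).
Implicit Types V W : normedModType R[i].

Lemma rnormE V (x : V) : `|x| = (rnorm x)%:C%C.
Proof.
have := normr_ge0 x; rewrite /rnorm; case: `|x| => a b; rewrite lecE /= => /andP[/eqP].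
by move=> -> _.
Qed.

Lemma rnorm_ge0 V (x : V) : 0 <= rnorm x.
Proof. by have := normr_ge0 x; rewrite rnormE lecR. Qed.

Lemma ler_rnorm V W (x : V) (y : W) (M : R) :
  `|x| <= M%:C%C * `|y| -> rnorm x <= M * rnorm y.
Proof. by rewrite !rnormE -rmorphM lecR. Qed.

Lemma bounded_ofP V W (f : {linear V -> W}) (M : R) :
  (forall x, rnorm (f x) <= M * rnorm x) -> continuous f.
Proof.
move=> fM; apply/linear_bounded_continuous/linear_boundedP.
exists (M%:C)%C; split; first by rewrite realE !lecE /= eqxx le_total.
move=> r Mr x; apply: le_trans (_ : (M%:C)%C * `|x| <= _); last first.
  by rewrite ler_wpM2r// ltW.
by rewrite !rnormE -rmorphM lecR.
Qed.

Lemma boundedOpP V W (f : boundedOp V W) :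
  exists2 M : R, 0 <= M & forall x, rnorm (f x) <= M * rnorm x.
Proof.
have /linear_bounded_continuous/linear_boundedP/pinfty_ex_gt0 [M M0 fM] :
  continuous f by exact: cts_fun.
exists (complex.Re M).
  by move: M0; rewrite ltcE /= => /andP[_ /ltW].
have MR : M = (complex.Re M)%:C%C.
  by move: M0; case: {fM}M => a b; rewrite ltcE/= => /andP[/eqP->].
by move=> x; apply: ler_rnorm; rewrite -MR; exact: fM.
Qed.

Lemma closure_normP V (A : set V) x :
  closure A x <-> forall e : R, 0 < e -> exists2 y, A y & rnorm (x - y) < e.
Proof.
split=> [Ax e e0|Ax B /nbhs_normP [e /= e0 eB]].
  have [|y [Ay xy]] := Ax (ball x e%:C%C).
    by apply: nbhsx_ballx; rewrite ltcR.
  by exists y => //; move: xy; rewrite -ball_normE/= rnormE ltcR.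
have er : e = ((complex.Re e)%:C)%C.
  by move: e0; case: {eB}e => a b; rewrite ltcE/= => /andP[/eqP ->].
have [|y Ay xy] := Ax (complex.Re e); first by move: e0; rewrite er ltcR.
by exists y; split => //; apply: eB; rewrite /= rnormE er ltcR.
Qed.

Lemma rnormZ V (a : R[i]) (x : V) : rnorm (a *: x) = rnorm (a : R[i]) * rnorm x.
Proof. by apply: (fmorph_inj (real_complex R)); rewrite rmorphM /= -!rnormE normrZ. Qed.

Lemma ler_rnormD V (x y : V) : rnorm (x + y) <= rnorm x + rnorm y.
Proof. by rewrite -lecR rmorphD /= -!rnormE ler_normD. Qed.

Lemma rnorm0 V : rnorm (0 : V) = 0.
Proof. by rewrite /rnorm normr0. Qed.

Lemma rnormN V (x : V) : rnorm (- x) = rnorm x.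
Proof. by rewrite /rnorm normrN. Qed.

End op_facts.

HB.instance Definition _ (K : numFieldType) (V W : normedModType K) :=
  @isContinuous.Build V W (\0) (fun x => cvg_cst (0 : W)).
(** Closure of the range of a bounded operator, as a type; this is [D_P] when
    applied to [D_P = (I - P^* P)^(1/2)]. *)
Section clran.
Context (R : realType) (V W : preHilbertType R) (T : boundedOp V W).

Definition in_clran : {pred W} := mem (closure (range T)).

Lemma in_clranP x : reflect (closure (range T) x) (x \in in_clran).
Proof. by apply: (iffP idP) => [/set_mem|/mem_set]. Qed.

Lemma in_clran_submod : GRing.submod_closed in_clran.
Proof.
split.
  by apply/in_clranP/subset_closure; exists 0; rewrite ?linear0.
move=> a x y /in_clranP/closure_normP xT /in_clranP/closure_normP yT.
apply/in_clranP/closure_normP => e e0.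
have a0 : 0 < rnorm (a : R[i]) + 1 by rewrite ltr_wpDl ?rnorm_ge0.
have [|_ [u _ <-] xu] := xT (e / 2 / (rnorm (a : R[i]) + 1)).
  by rewrite !divr_gt0.
have [|_ [v _ <-] yv] := yT (e / 2); first by rewrite divr_gt0.
exists (T (a *: u + v)); first by exists (a *: u + v).
rewrite linearP opprD addrACA -scalerBr (le_lt_trans (ler_rnormD _ _))//.
rewrite [ltRHS]splitr ler_ltD// rnormZ.
rewrite (le_trans _ (_ : (rnorm (a : R[i]) + 1) * rnorm (x - T u) <= _))//.
  by rewrite ler_wpM2r ?rnorm_ge0// lerDl.
by rewrite mulrC -ler_pdivlMr// ltW.
Qed.

HB.instance Definition _ :=
  GRing.isSubmodClosed.Build R[i] W in_clran in_clran_submod.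

Record clran := Clran { clran_val :> W ; _ : clran_val \in in_clran }.

HB.instance Definition _ := [isSub for clran_val].
HB.instance Definition _ := [Choice of clran by <:].
HB.instance Definition _ := [SubChoice_isSubLmodule of clran by <:].

Let cinner (x y : clran) := inner (val x) (val y).
Fact clran_linearl z : scalar (cinner^~ z).
Proof. by move=> a x y; rewrite /cinner linearP/= inner_linearl. Qed.
Fact clran_innerC x y : cinner x y = (cinner y x)^*%R.
Proof. exact: innerC. Qed.
Fact clran_inner_ge0 x : 0 <= cinner x x.
Proof. by rewrite /cinner inner_norm exprn_ge0. Qed.
Fact clran_inner_eq0 x : cinner x x = 0 -> x = 0.
Proof.
rewrite /cinner inner_norm => /eqP; rewrite expf_eq0/= normr_eq0 => /eqP x0.
by apply: val_inj; rewrite raddf0; exact: x0.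
Qed.
HB.instance Definition _ := Lmodule_isPreHilbert.Build R clran
  clran_linearl clran_innerC clran_inner_ge0 clran_inner_eq0.

Lemma range_in_clran x : T x \in in_clran.
Proof. by apply/in_clranP/subset_closure; exists x. Qed.

Definition to_clran (x : V) : clran := Clran (range_in_clran x).

End clran.

(** Hilbert space direct sum: the library norm on the product V * W is the max
    norm, so an alias of the product carries the Hilbert space structure. *)
Section dsum.
Context (R : realType) (V W : preHilbertType R).

Definition dsum : Type := V * W.

HB.instance Definition _ := GRing.Lmodule.copy dsum (V * W)%type.

Let dinner (x y : dsum) := inner x.1 y.1 + inner x.2 y.2.
Fact dsum_linearl z : scalar (dinner^~ z).
Proof. by move=> a x y; rewrite /dinner !inner_linearl mulrDr addrACA. Qed.
Fact dsum_innerC x y : dinner x y = (dinner y x)^*%R.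
Proof. by rewrite /dinner rmorphD/= -!innerC. Qed.
Fact dsum_inner_ge0 x : 0 <= dinner x x.
Proof. by rewrite /dinner !inner_norm addr_ge0// exprn_ge0. Qed.
Fact dsum_inner_eq0 x : dinner x x = 0 -> x = 0.
Proof.
case: x => u v; rewrite /dinner/= !inner_norm => /eqP.
rewrite paddr_eq0 ?exprn_ge0// !expf_eq0/= !normr_eq0.
by move=> /andP[/eqP-> /eqP->].
Qed.
HB.instance Definition _ := Lmodule_isPreHilbert.Build R dsum
  dsum_linearl dsum_innerC dsum_inner_ge0 dsum_inner_eq0.

End dsum.
(** Sum of an absolutely convergent complex series. *)
Section csum.
Context (R : realType).
Implicit Types z w : nat -> R[i].

Definition csummable z := cvgn (series (fun n => rnorm (z n : R[i]))).

Definition csum z : R[i] :=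
  Complex (limn (series (fun n => complex.Re (z n))))
          (limn (series (fun n => complex.Im (z n)))).

Lemma csummable_le z (b : nat -> R) :
  (forall n, rnorm (z n : R[i]) <= b n) -> cvgn (series b) -> csummable z.
Proof.
move=> zb; apply: series_le_cvg => // n; first exact: rnorm_ge0.
by apply: le_trans (zb n); exact: rnorm_ge0.
Qed.

Lemma ler_Re_rnorm (c : R[i]) : `|complex.Re c| <= rnorm c.
Proof. by have := normc_ge_Re c; rewrite rnormE lecR. Qed.

Lemma ler_Im_rnorm (c : R[i]) : `|complex.Im c| <= rnorm c.
Proof.
rewrite -lecR -rnormE normc_def lecR -sqrtr_sqr ler_wsqrtr//.
by rewrite lerDr sqr_ge0.
Qed.

Lemma csummable_Re z : csummable z -> cvgn (series (fun n => complex.Re (z n))).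
Proof.
move=> zs; apply: normed_cvg; apply: series_le_cvg zs => n //=.
- exact: rnorm_ge0.
- exact: ler_Re_rnorm.
Qed.

Lemma csummable_Im z : csummable z -> cvgn (series (fun n => complex.Im (z n))).
Proof.
move=> zs; apply: normed_cvg; apply: series_le_cvg zs => n //=.
- exact: rnorm_ge0.
- exact: ler_Im_rnorm.
Qed.

Lemma csummableZ a z : csummable z -> csummable (fun n => a * z n).
Proof.
move=> zs; apply: (@csummable_le _ (fun n => rnorm (a : R[i]) * rnorm (z n : R[i]))).
  by move=> n; rewrite -(rnormZ a (z n : R[i]^o)).
exact: is_cvg_seriesZ.
Qed.

Lemma csumE z (x y : nat -> R) :
  (forall n, complex.Re (z n) = x n) -> (forall n, complex.Im (z n) = y n) ->
  csum z = Complex (limn (series x)) (limn (series y)).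
Proof. by move=> /funext <- /funext <-. Qed.

Lemma csumD z w : csummable z -> csummable w ->
  csum (fun n => z n + w n) = csum z + csum w.
Proof.
move=> zs ws.
have [zr zi] := (csummable_Re zs, csummable_Im zs).
have [wr wi] := (csummable_Re ws, csummable_Im ws).
rewrite (@csumE _ ((fun n => complex.Re (z n)) + (fun n => complex.Re (w n)))
                  ((fun n => complex.Im (z n)) + (fun n => complex.Im (w n)))).
- by rewrite (lim_seriesD zr wr) (lim_seriesD zi wi).
- by move=> n; rewrite ?fctE /=; case: (z n); case: (w n).
- by move=> n; rewrite ?fctE /=; case: (z n); case: (w n).
Qed.

Lemma csumZ a z : csummable z -> csum (fun n => a * z n) = a * csum z.
Proof.
move=> zs; have [zr zi] := (csummable_Re zs, csummable_Im zs); case: a => a b.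
rewrite (@csumE _
  (a *: (fun n => complex.Re (z n)) - b *: (fun n => complex.Im (z n)))
  (a *: (fun n => complex.Im (z n)) + b *: (fun n => complex.Re (z n)))).
- rewrite (lim_seriesB (is_cvg_seriesZ (k:=a) zr) (is_cvg_seriesZ (k:=b) zi)).
  rewrite (lim_seriesD (is_cvg_seriesZ (k:=a) zi) (is_cvg_seriesZ (k:=b) zr)).
  by rewrite (lim_seriesZ a zr) (lim_seriesZ b zi) (lim_seriesZ a zi) (lim_seriesZ b zr).
- by move=> n; rewrite ?fctE /=; case: (z n).
- by move=> n; rewrite ?fctE /=; case: (z n).
Qed.

Lemma csum_conj z : csummable z -> csum (fun n => (z n)^*%R) = (csum z)^*%R.
Proof.
move=> zs; have zi := csummable_Im zs.
rewrite (@csumE _ (fun n => complex.Re (z n)) (- (fun n => complex.Im (z n)))).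
- by rewrite (lim_seriesN zi).
- by move=> n; rewrite ?fctE /=; case: (z n).
- by move=> n; rewrite ?fctE /=; case: (z n).
Qed.

End csum.

Lemma rnorm_inner (R : realType) (E : preHilbertType R) (x y : E) :
  rnorm (inner x y : R[i]) <= rnorm x ^+ 2 + rnorm y ^+ 2.
Proof.
suff : `|inner x y| <= `|x| ^+ 2 + `|y| ^+ 2.
  by rewrite !rnormE -!rmorphXn -rmorphD lecR.
have innerDl u v w : inner (u + v) w = inner u w + inner v w :> R[i].
  by have := inner_linearl w 1 u v; rewrite !scale1r mul1r.
have innerZl a u w : inner (a *: u) w = a * inner u w :> R[i].
  have i0 : inner 0 w = 0 :> R[i].
    by apply: (addrI (inner 0 w)); rewrite -innerDl !addr0.
  by have := inner_linearl w a u 0; rewrite i0 !addr0.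
have [->|z0] := eqVneq (inner x y) 0; first by rewrite normr0 addr_ge0 ?exprn_ge0.
set c := (inner x y)^*%R / `|inner x y|.
have cz : c * inner x y = `|inner x y|.
  by rewrite mulrAC [_^* * _]mulrC -normCK expr2 mulfK// normr_eq0.
have nc : `|c| = 1 by rewrite normrM norm_conjC normfV normr_id divff// normr_eq0.
have : 0 <= inner (c *: x - y) (c *: x - y) :> R[i].
  by rewrite inner_norm exprn_ge0.
have innerDr u v w : inner w (u + v) = inner w u + inner w v :> R[i].
  by rewrite innerC innerDl rmorphD /= -!innerC.
have innerZr d u w : inner w (d *: u) = d^*%R * inner w u :> R[i].
  by rewrite innerC innerZl rmorphM /= -innerC.
rewrite -scaleN1r !(innerDl, innerZl, innerDr, innerZr) !inner_norm (innerC y x).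
rewrite rmorphN rmorph1.
have -> : c * (c^*%R * `|x| ^+ 2 + -1 * inner x y) +
    -1 * (c^*%R * (inner x y)^*%R + -1 * `|y| ^+ 2) =
    c * c^*%R * `|x| ^+ 2 + `|y| ^+ 2 - (c * inner x y + c^*%R * (inner x y)^*%R).
  by ring.
have -> : c * c^*%R = 1 by rewrite -normCK nc expr1n.
have -> : c^*%R * (inner x y)^*%R = `|inner x y|.
  by rewrite -rmorphM cz /= (conj_Creal (normr_real _)).
rewrite mul1r cz.
rewrite subr_ge0; apply: le_trans; rewrite lerDl//.
Qed.

(** l^2(E), the square-summable sequences in E, with inner product
    [sum_n <a_n, b_n>]. *)
Section l2.
Context (R : realType) (E : preHilbertType R).

Definition sqsummable : {pred nat -> E} :=
  mem [set a : nat -> E | cvgn (series (fun n => rnorm (a n) ^+ 2))].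

Lemma sqsummableP a :
  reflect (cvgn (series (fun n => rnorm (a n : E) ^+ 2))) (a \in sqsummable).
Proof. by apply: (iffP idP) => [/set_mem|/mem_set]. Qed.

Lemma sqsummable_le a (b : nat -> R) : (forall n, rnorm (a n) ^+ 2 <= b n) ->
  cvgn (series b) -> a \in sqsummable.
Proof.
move=> ab bs; apply/sqsummableP; apply: series_le_cvg bs => // n.
  exact: sqr_ge0.
exact: le_trans (sqr_ge0 _) (ab n).
Qed.

Lemma sqsummable_submod : GRing.submod_closed sqsummable.
Proof.
split.
  apply: (@sqsummable_le _ (fun=> 0)) => [n|].
    by rewrite rnorm0 expr0n.
  rewrite (_ : series _ = fun=> 0); first exact: is_cvg_cst.
  by apply/funext => n; rewrite /series/= big1.
move=> c a b /sqsummableP sa /sqsummableP sb.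
apply: (@sqsummable_le _ (fun n => (2 * rnorm (c : R[i]) ^+ 2) * rnorm (a n) ^+ 2 + 2 * rnorm (b n) ^+ 2)) => [n|].
  rewrite -mulrA -exprMn -rnormZ.
  apply: (@le_trans _ _ ((rnorm (c *: a n) + rnorm (b n)) ^+ 2)).
    rewrite ler_pXn2r ?nnegrE ?addr_ge0 ?rnorm_ge0//; exact: ler_rnormD.
  rewrite -subr_ge0 (_ : _ - _ = (rnorm (c *: a n) - rnorm (b n)) ^+ 2) ?sqr_ge0//.
  ring.
rewrite (_ : (fun n => _) = (fun n => 2 * rnorm (c : R[i]) ^+ 2 * rnorm (a n) ^+ 2) \+ (fun n => 2 * rnorm (b n) ^+ 2))//.
by apply: is_cvg_seriesD; apply: is_cvg_seriesZ.
Qed.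

HB.instance Definition _ :=
  GRing.isSubmodClosed.Build R[i] (nat -> E) sqsummable sqsummable_submod.

Record l2 := L2 { l2_seq :> nat -> E ; _ : l2_seq \in sqsummable }.

HB.instance Definition _ := [isSub for l2_seq].
HB.instance Definition _ := [Choice of l2 by <:].
HB.instance Definition _ := [SubChoice_isSubLmodule of l2 by <:].

Let linner (a b : l2) := csum (fun n => inner (a n) (b n)).

Lemma l2_inner_summable (a b : l2) : csummable (fun n => inner (a n) (b n)).
Proof.
apply: (@csummable_le _ _ ((fun n => rnorm (a n) ^+ 2) \+ (fun n => rnorm (b n) ^+ 2))).
  by move=> n; exact: rnorm_inner.
by apply: is_cvg_seriesD; apply/sqsummableP; exact: valP.
Qed.

Fact l2_linearl z : scalar (linner^~ z).
Proof.
move=> c a b; rewrite /linner -csumZ; last exact: l2_inner_summable.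
rewrite -csumD; [|exact/csummableZ/l2_inner_summable|exact: l2_inner_summable].
by congr csum; apply/funext => n; rewrite -inner_linearl.
Qed.
Fact l2_innerC a b : linner a b = (linner b a)^*%R.
Proof.
rewrite /linner -csum_conj; last exact: l2_inner_summable.
by congr csum; apply/funext => n; rewrite -innerC.
Qed.

Lemma l2_inner_norm a : linner a a =
  ((limn (series (fun n => rnorm (a n) ^+ 2)))%:C)%C.
Proof.
have E1 n : inner (a n) (a n) = ((rnorm (a n) ^+ 2)%:C)%C.
  by rewrite inner_norm rnormE -rmorphXn.
rewrite /linner /csum; congr Complex.
  by congr (limn (series _)); apply/funext => n; rewrite E1.
rewrite (_ : series _ = fun=> 0); first exact: lim_cst.
by apply/funext => n; rewrite /series/= big1// => i _; rewrite E1.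
Qed.

Lemma l2_ge_partial (a : l2) n :
  rnorm (a n) ^+ 2 <= limn (series (fun n => rnorm (a n) ^+ 2)).
Proof.
apply: (@le_trans _ _ (series (fun n => rnorm (a n) ^+ 2) n.+1)).
  by rewrite /series/= big_nat_recr//= lerDr sumr_ge0// => i _; exact: sqr_ge0.
apply: nondecreasing_cvgn_le; last by apply/sqsummableP; exact: valP.
by apply: nondecreasing_series => i _ _; exact: sqr_ge0.
Qed.

Fact l2_inner_ge0 a : 0 <= linner a a.
Proof.
by rewrite l2_inner_norm lecR (le_trans _ (l2_ge_partial a 0))// sqr_ge0.
Qed.
Fact l2_inner_eq0 a : linner a a = 0 -> a = 0.
Proof.
rewrite l2_inner_norm => -[a0]; apply/val_inj/funext => n; rewrite raddf0.
apply/eqP; rewrite -normr_eq0 rnormE; apply/eqP; congr (Complex _ 0).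
apply/eqP; rewrite -sqrf_eq0 eq_le sqr_ge0 andbT.
by rewrite (le_trans (l2_ge_partial a n))// a0.
Qed.
HB.instance Definition _ := Lmodule_isPreHilbert.Build R l2
  l2_linearl l2_innerC l2_inner_ge0 l2_inner_eq0.

Lemma l2_cons_subproof x (a : l2) :
  (fun n => if n is m.+1 then a m else x) \in sqsummable.
Proof.
apply/sqsummableP; apply/cvg_ex.
have /sqsummableP/cvg_ex[l al] := valP a.
exists (rnorm x ^+ 2 + l); rewrite -(cvg_shiftn 1)/=.
rewrite (_ : (fun n => _) = (fun n => rnorm x ^+ 2 + series (fun n => rnorm (a n) ^+ 2) n)).
  by apply: cvgD => //; exact: cvg_cst.
by apply/funext => n; rewrite addn1 /series/= big_nat_recl.
Qed.
(** (x, a_0, a_1, ...) *)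
Definition l2_cons x a := L2 (l2_cons_subproof x a).

Lemma l2_tail_subproof (a : l2) : (fun n => a n.+1) \in sqsummable.
Proof.
apply/sqsummableP; apply/cvg_ex.
have /sqsummableP/cvg_ex[l al] := valP a.
exists (l - rnorm (a 0%N) ^+ 2).
rewrite (_ : series _ = (fun n => series (fun n => rnorm (a n) ^+ 2) (n + 1)%N - rnorm (a 0%N) ^+ 2)).
  apply: cvgB; last exact: cvg_cst.
  by rewrite (cvg_shiftn 1 (series _)).
by apply/funext => n; rewrite addn1 /series/= big_nat_recl// addrAC subrr add0r.
Qed.
(** (a_1, a_2, ...) *)
Definition l2_tail a := L2 (l2_tail_subproof a).

End l2.

Lemma l2_map_subproof (R : realType) (E F : preHilbertType R)
    (T : boundedOp E F) (a : l2 E) : T \o a \in @sqsummable R F.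
Proof.
have [M M0 TM] := boundedOpP T.
apply: (@sqsummable_le _ _ _ (fun n => M ^+ 2 * rnorm (a n) ^+ 2)) => [n|].
  by rewrite -exprMn ler_pXn2r ?nnegrE ?mulr_ge0 ?rnorm_ge0//; exact: TM.
by apply: is_cvg_seriesZ; apply/sqsummableP; exact: valP.
Qed.
(** (T a_0, T a_1, ...) *)
Definition l2_map (R : realType) (E F : preHilbertType R)
  (T : boundedOp E F) (a : l2 E) : l2 F := L2 (l2_map_subproof T a).
Section cauchy.
Context (R : realType).
Implicit Types V W : normedModType R[i].

Lemma complex_gt0 (e : R[i]) : 0 < e -> exists2 r : R, 0 < r & e = r%:C%C.
Proof.
by case: e => a b; rewrite ltcE/= => /andP[/eqP-> a0]; exists a.
Qed.

Lemma cauchy_rnormP V (F : set_system V) : ProperFilter F ->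
  cauchy F <-> forall e : R, 0 < e -> exists x, F [set y | rnorm (x - y) < e].
Proof.
move=> FF; split=> [/cauchyP Fc e e0|Fc].
  have [|x xF] := Fc e%:C%C; first by rewrite ltcR.
  exists x; apply: filterS xF => y; rewrite -ball_normE /= rnormE ltcR.
  exact.
apply/cauchyP => e /complex_gt0[r r0 ->]; have [x xF] := Fc _ r0.
exists x; apply: filterS xF => y /=; rewrite -ball_normE /= rnormE ltcR.
exact.
Qed.

Lemma cvg_rnormP V (F : set_system V) (l : V) : Filter F ->
  F --> l <-> forall e : R, 0 < e -> F [set y | rnorm (l - y) < e].
Proof.
move=> FF; split=> [/fcvgrPdist_lt Fl e e0|Fl].
  have := Fl e%:C%C; rewrite ltcR => /(_ e0); apply: filterS => y /=.
  by rewrite rnormE ltcR.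
apply/fcvgrPdist_lt => e /complex_gt0[r r0 ->]; apply: filterS (Fl _ r0) => y /=.
by rewrite rnormE ltcR.
Qed.

Lemma cauchy_image V (W : completeNormedModType R[i]) (f : V -> W)
    (F : set_system V) : ProperFilter F -> cauchy F ->
  (forall x y, rnorm (f x - f y) <= rnorm (x - y)) ->
  exists l, forall e : R, 0 < e -> F [set y | rnorm (l - f y) < e].
Proof.
move=> FF /cauchy_rnormP Fc f1.
have /cauchy_cvg/cvg_ex[l /cvg_rnormP fl] : cauchy (f @ F).
  apply/cauchy_rnormP => e /Fc[x xF]; exists (f x).
  by apply: (@filterS _ F _ _ _ _ xF) => y /=; exact: le_lt_trans.
by exists l => e /fl.
Qed.

End cauchy.

Section complete.
Context (R : realType).

Lemma sqr_rnorm (V : preHilbertType R) (x : V) :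
  ((rnorm x ^+ 2)%:C)%C = inner x x.
Proof. by rewrite inner_norm rnormE -rmorphXn. Qed.

Lemma rnorm_eq_sqr (V W : normedModType R[i]) (x : V) (y : W) :
  rnorm x ^+ 2 = rnorm y ^+ 2 -> rnorm x = rnorm y.
Proof.
by move=> xy; apply/eqP; rewrite -(@eqrXn2 _ 2) ?rnorm_ge0//; apply/eqP.
Qed.

Lemma rnorm_clran (V W : preHilbertType R) (T : boundedOp V W) (x : clran T) :
  rnorm x = rnorm (x : W).
Proof.
apply: rnorm_eq_sqr; apply: (fmorph_inj (real_complex R)).
by rewrite /= !sqr_rnorm.
Qed.

Lemma rnorm_dsum (V W : preHilbertType R) (x : dsum V W) :
  rnorm x ^+ 2 = rnorm x.1 ^+ 2 + rnorm x.2 ^+ 2.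
Proof.
by apply: (fmorph_inj (real_complex R)); rewrite rmorphD /= !sqr_rnorm.
Qed.

Lemma rnorm_l2 (E : preHilbertType R) (a : l2 E) :
  rnorm a ^+ 2 = limn (series (fun n => rnorm (a n) ^+ 2)).
Proof.
by apply: (fmorph_inj (real_complex R)); rewrite /= sqr_rnorm -l2_inner_norm.
Qed.

Lemma clran_complete (V : preHilbertType R) (W : hilbertType R)
    (T : boundedOp V W) (F : set_system (clran T)) :
  ProperFilter F -> cauchy F -> cvg F.
Proof.
move=> FF Fc.
have [|l Fl] := cauchy_image (f := @clran_val _ _ _ T) FF Fc.
  by move=> x y; rewrite rnorm_clran.
have lT : l \in in_clran T.
  apply/in_clranP/closure_normP => e e0.
  have e20 : 0 < e / 2 by rewrite divr_gt0.
  have /filter_ex[x /= lx] := Fl _ e20.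
  have /in_clranP/closure_normP/(_ _ e20)[y yT xy] := valP x.
  exists y => //; rewrite -(subrKA (val x)) (le_lt_trans (ler_rnormD _ _))//.
  by rewrite [ltRHS]splitr ltrD.
apply/cvg_ex; exists (Clran lT); apply/cvg_rnormP => e /Fl.
by apply: filterS => y /=; rewrite rnorm_clran.
Qed.

Lemma dsum_complete (V W : hilbertType R) (F : set_system (dsum V W)) :
  ProperFilter F -> cauchy F -> cvg F.
Proof.
move=> FF Fc.
have [|l1 F1] := cauchy_image (f := (fun x : dsum V W => x.1)) FF Fc.
  move=> x y; rewrite -(@ler_pXn2r _ 2) ?nnegrE ?rnorm_ge0// rnorm_dsum.
  by rewrite lerDl sqr_ge0.
have [|l2 F2] := cauchy_image (f := (fun x : dsum V W => x.2)) FF Fc.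
  move=> x y; rewrite -(@ler_pXn2r _ 2) ?nnegrE ?rnorm_ge0// rnorm_dsum.
  by rewrite lerDr sqr_ge0.
apply/cvg_ex; exists ((l1, l2) : dsum V W); apply/cvg_rnormP => e e0.
have e20 : 0 < e / 2 by rewrite divr_gt0.
apply: filterS2 (F1 _ e20) (F2 _ e20) => x /= x1 x2.
rewrite -(@ltr_pXn2r _ 2) ?nnegrE ?rnorm_ge0 ?(ltW e0)// rnorm_dsum /=.
apply: (@lt_le_trans _ _ ((e / 2) ^+ 2 + (e / 2) ^+ 2)).
  by rewrite ltrD// ltr_pXn2r ?nnegrE ?rnorm_ge0 ?(ltW e20).
rewrite (_ : _ + _ = e ^+ 2 / 2); last by field.
by rewrite ler_piMr ?sqr_ge0// invf_le1// ler1n.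
Qed.

Lemma l2_complete (E : hilbertType R) (F : set_system (l2 E)) :
  ProperFilter F -> cauchy F -> cvg F.
Proof.
move=> FF Fc.
have /choice[b Fb] n : exists l : E, forall e : R, 0 < e ->
    F [set y | rnorm (l - (y : l2 E) n) < e].
  apply: (cauchy_image (f := (fun x : l2 E => x n))) => // x y.
  rewrite -(@ler_pXn2r _ 2) ?nnegrE ?rnorm_ge0// rnorm_l2.
  exact: (l2_ge_partial (x - y) n).
have FbN N (e : R) : 0 < e ->
    F [set y : l2 E | forall k, (k < N)%N -> rnorm (b k - y k) < e].
  move=> e0; elim: N => [|N IH]; first by apply: filterS filterT.
  apply: filterS2 IH (Fb N _ e0) => y yN yN1 k.
  by rewrite ltnS leq_eqVlt => /predU1P[->//|/yN].
have bnd (x : l2 E) (e : R) N : 0 < e -> F [set y | rnorm (x - y) < e] ->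
    series (fun n => rnorm (b n - x n) ^+ 2) N <= 4 * e ^+ 2.
  move=> e0 Fx.
  have d0 : 0 < e / N.+1%:R by rewrite divr_gt0.
  have [y [/= xy yb]] := filter_ex (filterI Fx (FbN N _ d0)).
  have sqD (u v : R) : (u + v) ^+ 2 <= 2 * u ^+ 2 + 2 * v ^+ 2.
    rewrite -subr_ge0 (_ : _ - _ = (u - v) ^+ 2) ?sqr_ge0//; ring.
  apply: (@le_trans _ _ (\sum_(0 <= k < N)
     (2 * (e / N.+1%:R) ^+ 2 + 2 * rnorm ((x - y) k) ^+ 2))).
    rewrite /series/= big_nat_cond [leRHS]big_nat_cond ler_sum// => k.
    rewrite andbT => /andP[_ kN].
    apply: (@le_trans _ _ ((rnorm (b k - y k) + rnorm (x k - y k)) ^+ 2)).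
      rewrite ler_pXn2r ?nnegrE ?addr_ge0 ?rnorm_ge0//.
      by rewrite -(rnormN (x k - y k)) opprB -(subrKA (y k)) ler_rnormD.
    rewrite (le_trans (sqD _ _))// lerD2r ler_wpM2l//.
    by rewrite ler_pXn2r ?nnegrE ?rnorm_ge0 ?(ltW d0)// ltW ?yb.
  rewrite big_split/= -[X in X + _]mulr_sumr -[X in _ + X]mulr_sumr sumr_const_nat subn0.
  rewrite (_ : 4 * e ^+ 2 = 2 * e ^+ 2 + 2 * e ^+ 2); last by ring.
  apply: lerD.
    rewrite ler_wpM2l// -[leLHS]mulr_natr expr_div_n -mulrA ler_piMr ?sqr_ge0//.
    rewrite mulrC ler_pdivrMr ?exprn_gt0// mul1r -natrX ler_nat.
    by rewrite (leq_trans (leqnSn N))// -{1}(expn1 N.+1) leq_pexp2l.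
  rewrite ler_wpM2l// (@le_trans _ _ (rnorm (x - y) ^+ 2))//.
    rewrite rnorm_l2; apply: nondecreasing_cvgn_le.
      by apply: nondecreasing_series => i _ _; exact: sqr_ge0.
    by apply/sqsummableP; exact: (valP (x - y)).
  by rewrite ler_pXn2r ?nnegrE ?rnorm_ge0 ?(ltW e0)// ltW.
have smb (x : l2 E) (e : R) : 0 < e -> F [set y | rnorm (x - y) < e] ->
    (fun n => b n - x n) \in @sqsummable R E.
  move=> e0 Fx; apply/sqsummableP; apply: nondecreasing_is_cvgn.
    by apply: nondecreasing_series => i _ _; exact: sqr_ge0.
  by exists (4 * e ^+ 2) => _ [N _ <-]; exact: bnd.
move/cauchy_rnormP : (Fc) => {}Fc.
have bl2 : b \in @sqsummable R E.
  have [x Fx] := Fc 1 ltr01.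
  rewrite (_ : b = (fun n => b n - x n) + (x : nat -> E)).
    by apply: rpredD; [exact: smb Fx | exact: valP].
  by apply/funext => n; rewrite fctE subrK.
apply/cvg_ex; exists (L2 bl2); apply/cvg_rnormP => e e0.
have e80 : 0 < e / 8 by rewrite divr_gt0.
have [x Fx] : exists x : l2 E, F [set y | rnorm (x - y) < e / 8] := Fc _ e80.
suff h (y : l2 E) : rnorm (x - y) < e / 8 -> rnorm (L2 bl2 - y) < e.
  by apply: filterS Fx => y; exact: h.
move=> xy.
have e81 : 0 <= 2 * (e / 8) by apply: mulr_ge0 => //; exact: ltW.
have bx : rnorm (L2 bl2 - x) <= 2 * (e / 8).
  rewrite -(@ler_pXn2r _ 2) ?nnegrE ?rnorm_ge0 ?e81//. rewrite rnorm_l2.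
  apply: limr_le; first by apply/sqsummableP; exact: (valP (L2 bl2 - x)).
  apply: nearW => N; rewrite (_ : (_ * _) ^+ 2 = 4 * (e / 8) ^+ 2); last by ring.
  exact: bnd.
have := ler_rnormD (L2 bl2 - x) (x - y); rewrite subrKA => /le_lt_trans; apply.
apply: (le_lt_trans (lerD bx (ltW xy))).
by rewrite (_ : _ + _ = e * (3 / 8)); [rewrite gtr_pMr// ltr_pdivrMr// mul1r ltr_nat|field].
Qed.

End complete.

HB.instance Definition _ (R : realType) (V : preHilbertType R)
    (W : hilbertType R) (T : boundedOp V W) :=
  Uniform_isComplete.Build (clran T) (@clran_complete R V W T).
HB.instance Definition _ (R : realType) (V W : hilbertType R) :=
  Uniform_isComplete.Build (dsum V W) (@dsum_complete R V W).
HB.instance Definition _ (R : realType) (E : hilbertType R) :=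
  Uniform_isComplete.Build (l2 E) (@l2_complete R E).

Definition is_adjoint (R : realType) (V W : hilbertType R)
    (T : V -> W) (S : W -> V) :=
  forall x y, inner (T x) y = inner x (S y).

(** Every bounded operator between Hilbert spaces has exactly one bounded
    adjoint, so the default value is only reached when T is not bounded. *)
Definition adj (R : realType) (V W : hilbertType R) (T : V -> W) :
    boundedOp W V :=
  if pselect (exists S : boundedOp W V, is_adjoint T S) is left e
  then sval (cid e) else (\0 : boundedOp W V).

Definition opnorm (R : realType) (V W : normedModType R[i]) (T : V -> W) : R :=
  sup [set rnorm (T x) | x in [set x | rnorm x <= 1]].

Definition lspan (K : pzRingType) (V : lmodType K) (S : set V) : set V :=
  [set x | exists n (c : 'I_n -> K) (v : 'I_n -> V),
     (forall i, S (v i)) /\ x = \sum_(i < n) c i *: v i].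

Definition commutator (V : zmodType) (X Y : V -> V) : V -> V :=
  fun x => X (Y x) - Y (X x).

Section tetrablock.
Context (R : realType).

Definition euclid_norm n (v : 'cV[R[i]]_n) : R :=
  Num.sqrt (\sum_i rnorm (v i 0 : R[i]) ^+ 2).

Definition mx_opnorm m n (A : 'M[R[i]]_(m, n)) : R :=
  sup [set euclid_norm (A *m v) | v in [set v | euclid_norm v <= 1]].

Definition tetrablock : set (R[i] * R[i] * R[i]) :=
  [set (A 0 0, A 1 1, \det A) | A in [set A : 'M[R[i]]_2 | mx_opnorm A < 1]].

End tetrablock.

Section tetrablock_contraction.
Context (R : realType) (H : hilbertType R).
Implicit Types A B P : H -> H.

(** Exactness of the Koszul complex 0 -> H -> H^3 -> H^3 -> H -> 0
    of a commuting triple, with differential [x |-> sum_i e_i /\ T_i x]. *)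
Definition koszul_exact A B P :=
  [/\ forall x, A x = 0 -> B x = 0 -> P x = 0 -> x = 0,
      forall x1 x2 x3,
        A x2 - B x1 = 0 -> A x3 - P x1 = 0 -> B x3 - P x2 = 0 ->
        exists x, [/\ x1 = A x, x2 = B x & x3 = P x],
      forall x12 x13 x23, A x23 - B x13 + P x12 = 0 ->
        exists x1 x2 x3, [/\ x12 = A x2 - B x1, x13 = A x3 - P x1
                           & x23 = B x3 - P x2]
    & forall x123, exists x12 x13 x23, x123 = A x23 - B x13 + P x12].

(** The Taylor joint spectrum of a commuting triple. *)
Definition joint_spectrum A B P : set (R[i] * R[i] * R[i]) :=
  [set z | ~ koszul_exact (fun x => A x - z.1.1 *: x)
                          (fun x => B x - z.1.2 *: x)
                          (fun x => P x - z.2 *: x)].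

Definition poly3_eval (f : mpoly.mpoly 3 R[i]) (z : R[i] * R[i] * R[i]) : R[i] :=
  mpoly.meval (fun i : 'I_3 => [:: z.1.1; z.1.2; z.2]`_i) f.

Definition poly3_op (f : mpoly.mpoly 3 R[i]) A B P : H -> H := fun x =>
  \sum_(m <- mpoly.msupp f) mpoly.mcoeff m f *:
    iter (mpoly.fun_of_multinom m 0) A
      (iter (mpoly.fun_of_multinom m 1) B
        (iter (mpoly.fun_of_multinom m 2%R) P x)).

Definition tetrablock_contraction (A B P : boundedOp H H) :=
  [/\ [/\ A \o B =1 B \o A, A \o P =1 P \o A & B \o P =1 P \o B],
      joint_spectrum A B P `<=` closure (@tetrablock R)
    & forall f, opnorm (poly3_op f A B P) <=
        sup [set rnorm (poly3_eval f z : R[i]) | z in closure (@tetrablock R)]].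

(** [D = (I - T^* T)^(1/2)]: positive square roots are unique, and positive
    operators on a complex Hilbert space are self-adjoint. *)
Definition is_defect_op (T D : boundedOp H H) :=
  (forall x, 0 <= inner (D x) x) /\ (forall x, D (D x) = x - adj T (T x)).

Definition fundamental_ops (A B P D : boundedOp H H)
    (F1 F2 : boundedOp (clran D) (clran D)) :=
  forall h, A h - adj B (P h) = D (val (F1 (to_clran D h))) /\
            B h - adj A (P h) = D (val (F2 (to_clran D h))).

End tetrablock_contraction.

Section dilation.
Context (R : realType) (H : hilbertType R) (A B P DP DPs : boundedOp H H).
Local Notation cDP := (clran DP).
Local Notation cDPs := (clran DPs).
Local Notation Ht := (dsum H (l2 cDP)).
Local Notation K := (dsum Ht (l2 cDPs)).

(** [P^* : D_{P^*} -> D_P].  Since [P^* D_{P^*} = D_P P^*], the operator [P^*]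
    maps [D_{P^*}] into [D_P] and [insubd] never takes its default value. *)
Definition adjP_defect (x : cDPs) : cDP := insubd 0 (adj P (val x)).

(** [h (+) a |-> T h (+) (F'^* D_P h + F a_0, F'^* a_0 + F a_1, ...)] *)
Definition dilV (T : boundedOp H H) (F F' : boundedOp cDP cDP) (x : Ht) : Ht :=
  (T x.1, l2_cons (adj F' (to_clran DP x.1)) (l2_map (adj F') x.2)
          + l2_map F x.2).

(** [h (+) a |-> P h (+) (D_P h, a_0, a_1, ...)] *)
Definition dilV3 (x : Ht) : Ht := (P x.1, l2_cons (to_clran DP x.1) x.2).

(** [a |-> D_{P^*} G a_0 (+) (- F^* P^* a_0, 0, ...)] *)
Definition dilC (F : boundedOp cDP cDP) (G : boundedOp cDPs cDPs)
    (a : l2 cDPs) : Ht :=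
  (DPs (val (G (a 0%N))), l2_cons (- adj F (adjP_defect (a 0%N))) 0).

(** [a |-> D_{P^*} a_0 (+) (- P^* a_0, 0, ...)] *)
Definition dilC3 (a : l2 cDPs) : Ht :=
  (DPs (val (a 0%N)), l2_cons (- adjP_defect (a 0%N)) 0).

(** [a |-> (G^* a_0 + G' a_1, G^* a_1 + G' a_2, ...)] *)
Definition dilD (G G' : boundedOp cDPs cDPs) (a : l2 cDPs) : l2 cDPs :=
  l2_map (adj G) a + l2_map G' (l2_tail a).

Definition block_triangular (V : Ht -> Ht) (C : l2 cDPs -> Ht)
    (D : l2 cDPs -> l2 cDPs) (x : K) : K :=
  (V x.1 + C x.2, D x.2).

Definition dilR1 (F1 F2 : boundedOp cDP cDP) (G1 G2 : boundedOp cDPs cDPs) :=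
  block_triangular (dilV A F1 F2) (dilC F2 G2) (dilD G1 G2).

Definition dilR2 (F1 F2 : boundedOp cDP cDP) (G1 G2 : boundedOp cDPs cDPs) :=
  block_triangular (dilV B F2 F1) (dilC F1 G1) (dilD G2 G1).

Definition dilU := block_triangular dilV3 dilC3 (@l2_tail _ _).

Definition dil_embed (h : H) : K := ((h, 0), 0).

End dilation.

Arguments dilU {R H} P DP DPs.
Arguments dil_embed {R H} DP DPs h.

(* Main.v *)
From HB Require Import structures.
Require Import Defs.
From mathcomp Require Import all_boot all_order all_algebra.
From mathcomp Require Import complex.
From mathcomp Require Import ring lra.
From mathcomp Require Import all_classical all_reals interval_inference topology normedtype sequences.
Set Implicit Arguments.
Unset Strict Implicit.
Unset Printing Implicit Defensive.
Import Order.TTheory GRing.Theory Num.Theory.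
Import numFieldNormedType.Exports.
Local Open Scope classical_set_scope.
Local Open Scope ring_scope.

(** Already the unitary [U] and its adjoint generate the whole space: for [h] in
    [H], [U^(k+1) h - U^k (P h)] is [D_P h] placed in the [k]-th coordinate of
    [l2(D_P)], and [U*^(k+1) h - U*^k (P* h)] is [D_{P*} h] placed in the
    [k]-th coordinate of [l2(D_{P*})].  Hence a vector orthogonal to all these
    words vanishes coordinate by coordinate, and density follows from the
    orthogonal projection theorem. *)

Lemma rnorm_eq0 (R : realType) (V : normedModType R[i]) (x : V) : rnorm x = 0 -> x = 0.
Proof. by move=> x0; apply/eqP; rewrite -normr_eq0 rnormE x0. Qed.

(** * Inner product calculus and the Cauchy-Schwarz inequality *)

Section inner_product.
Context (R : realType) (V : preHilbertType R).
Implicit Types (x y z : V) (a : R[i]).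

Lemma innerDl x y z : inner (x + y) z = inner x z + inner y z.
Proof. by have := inner_linearl z 1 x y; rewrite !scale1r mul1r. Qed.

Lemma inner0l z : inner 0 z = 0.
Proof. by apply: (addrI (inner 0 z)); rewrite -innerDl !addr0. Qed.

Lemma innerZl a x z : inner (a *: x) z = a * inner x z.
Proof. by have := inner_linearl z a x 0; rewrite inner0l !addr0. Qed.

Lemma innerNl x z : inner (- x) z = - inner x z.
Proof. by rewrite -scaleN1r innerZl mulN1r. Qed.

Lemma innerBl x y z : inner (x - y) z = inner x z - inner y z.
Proof. by rewrite innerDl innerNl. Qed.

Lemma innerDr x y z : inner z (x + y) = inner z x + inner z y.
Proof. by rewrite innerC innerDl rmorphD /= -!innerC. Qed.

Lemma inner0r z : inner z 0 = 0.
Proof. by rewrite innerC inner0l conjC0. Qed.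

Lemma innerZr a x z : inner z (a *: x) = a^*%R * inner z x.
Proof. by rewrite innerC innerZl rmorphM /= -innerC. Qed.

Lemma innerNr x z : inner z (- x) = - inner z x.
Proof. by rewrite innerC innerNl rmorphN /= -innerC. Qed.

Lemma innerBr x y z : inner z (x - y) = inner z x - inner z y.
Proof. by rewrite innerDr innerNr. Qed.

Lemma inner_eq0 x : inner x x = 0 -> x = 0.
Proof.
by rewrite inner_norm => /eqP; rewrite expf_eq0/= normr_eq0 => /eqP.
Qed.

Lemma inner_inj x y : (forall z, inner z x = inner z y) -> x = y.
Proof.
by move=> xy; apply/eqP; rewrite -subr_eq0; apply/eqP/inner_eq0;
  rewrite innerBr xy subrr.
Qed.

Lemma Re_inner_xx x : complex.Re (inner x x) = rnorm x ^+ 2.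
Proof. by rewrite -sqr_rnorm. Qed.

Lemma Re_innerC x y : complex.Re (inner x y) = complex.Re (inner y x).
Proof. by rewrite innerC; case: (inner y x). Qed.

Lemma ReD a b : complex.Re (a + b) = complex.Re a + complex.Re b.
Proof. by case: a => ? ?; case: b. Qed.

Lemma rnorm_sqrD x y :
  rnorm (x + y) ^+ 2 = rnorm x ^+ 2 + 2 * complex.Re (inner x y) + rnorm y ^+ 2.
Proof.
rewrite -!Re_inner_xx !(innerDl, innerDr) !ReD (Re_innerC y x); ring.
Qed.

Lemma Re_innerZr (t : R) x y :
  complex.Re (inner x ((t%:C)%C *: y)) = t * complex.Re (inner x y).
Proof.
by rewrite innerZr; case: (inner x y) => u v /=; rewrite oppr0 mul0r subr0.
Qed.

Lemma rnormZr (t : R) x : rnorm ((t%:C)%C *: x) ^+ 2 = t ^+ 2 * rnorm x ^+ 2.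
Proof.
rewrite -!Re_inner_xx Re_innerZr Re_innerC Re_innerZr; ring.
Qed.

(** Expanding the square of the norm of [|y| x - |x| y] gives [2|x||y| (|x||y| - Re <x,y>) >= 0].
    The zero norms are split off first so that the factor [2|x||y|] can be cancelled. *)
Lemma Re_inner_le x y : complex.Re (inner x y) <= rnorm x * rnorm y.
Proof.
have [y0|y0] := eqVneq (rnorm y) 0.
  suff -> : y = 0 by rewrite inner0r rnorm0 mulr0.
  by apply/eqP; rewrite -normr_eq0 rnormE y0.
have yp : 0 < rnorm y by rewrite lt_neqAle eq_sym y0 rnorm_ge0.
have := sqr_ge0 (rnorm ((rnorm y)%:C%C *: x + ((- rnorm x)%:C)%C *: y)).
rewrite rnorm_sqrD !rnormZr Re_innerZr Re_innerC Re_innerZr (Re_innerC y x).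
have [x0|x0] := eqVneq (rnorm x) 0.
  suff -> : x = 0 by rewrite inner0l rnorm0 mul0r.
  by apply/eqP; rewrite -normr_eq0 rnormE x0.
have xp : 0 < rnorm x by rewrite lt_neqAle eq_sym x0 rnorm_ge0.
move=> h; have : 0 <= 2 * (rnorm x * rnorm y) *
    (rnorm x * rnorm y - complex.Re (inner x y)) by nra.
by rewrite pmulr_rge0 ?subr_ge0// mulr_gt0// mulr_gt0.
Qed.

Lemma parallelogram x y :
  rnorm (x + y) ^+ 2 + rnorm (x - y) ^+ 2 = 2 * rnorm x ^+ 2 + 2 * rnorm y ^+ 2.
Proof.
rewrite !rnorm_sqrD rnormN innerNr.
have -> : complex.Re (- inner x y) = - complex.Re (inner x y) by case: (inner x y).
ring.
Qed.

(** Multiplying [x] by a unimodular scalar makes the inner product real and nonnegative, which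
    reduces the modulus to the real part. *)
Lemma rnorm_inner_le x y : rnorm (inner x y : R[i]) <= rnorm x * rnorm y.
Proof.
set z := inner x y.
have [->|z0] := eqVneq z 0; first by rewrite rnorm0 mulr_ge0 ?rnorm_ge0.
have nz : (`|z| : R[i]) != 0 by rewrite normr_eq0.
pose c : R[i] := z^*%R / `|z|.
have cz : c * z = `|z| by rewrite mulrAC [_^* * _]mulrC -normCK expr2 mulfK.
have nc : rnorm (c : R[i]) = 1.
  by rewrite /rnorm normrM norm_conjC normfV normr_id divff.
have := Re_inner_le (c *: x) y.
by rewrite innerZl cz rnormZ nc mul1r.
Qed.

End inner_product.

(** * Nearest points and orthogonal projection *)

Section projection.
Context (R : realType) (V : hilbertType R).
Implicit Types (x y z : V) (S : set V).

(** Closedness is left out so that spans, ranges and kernels all fit; nearest points are therefore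
    sought in [closure S]. *)
Definition lin_subspace (S : set V) :=
  S 0 /\ forall (a : R[i]) x y, S x -> S y -> S (a *: x + y).

Lemma subspaceZ S (a : R[i]) x : lin_subspace S -> S x -> S (a *: x).
Proof. by move=> [S0 SP] Sx; have := SP a _ _ Sx S0; rewrite addr0. Qed.

Lemma subspaceD S x y : lin_subspace S -> S x -> S y -> S (x + y).
Proof. by move=> [S0 SP] Sx Sy; have := SP 1 _ _ Sx Sy; rewrite scale1r. Qed.

(** The midpoint of [m N] and [m n] lies in [S], so its squared distance to [x] is at least [d]. The
    parallelogram law then bounds [|m N - m n|^2] by [4/(N+1)] for [N <= n], and completeness gives
    the limit. *)
Lemma minimizing_sequence_cvg S x (m : nat -> V) (d : R) : lin_subspace S ->
  (forall n, S (m n)) -> (forall s, S s -> d <= rnorm (x - s) ^+ 2) ->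
  (forall n, rnorm (x - m n) ^+ 2 < d + n.+1%:R^-1) ->
  exists l, forall e : R, 0 < e -> \forall n \near \oo, rnorm (l - m n) < e.
Proof.
move=> SS Sm dS md.
have mm N n : (N <= n)%N -> rnorm (m N - m n) ^+ 2 <= 4 * N.+1%:R^-1.
  move=> Nn.
  set h := (2^-1 : R)%:C%C : R[i].
  have Smid : S (h *: (m N + m n)) by apply: subspaceZ => //; exact: subspaceD.
  have h2 : h + h = 1 by rewrite -rmorphD (_ : _ + _ = 1 :> R) ?rmorph1//; field.
  have /dS := Smid.
  have -> : x - h *: (m N + m n) = h *: ((x - m N) + (x - m n)).
    by rewrite addrACA -opprD scalerBr [h *: (x + x)]scalerDr -scalerDl h2 scale1r.
  rewrite rnormZr => dh.
  have := parallelogram (x - m N) (x - m n).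
  have -> : x - m N - (x - m n) = - (m N - m n).
    by rewrite opprB addrC subrKA opprB.
  rewrite rnormN => par.
  have := md N; have := md n.
  have : n.+1%:R^-1 <= N.+1%:R^-1 :> R by rewrite lef_pV2 ?posrE// ler_nat.
  move: dh par; set u := rnorm _ ^+ 2; set v := rnorm (m N - m n) ^+ 2.
  by move: n.+1%:R^-1 N.+1%:R^-1 => p q *; lra.
have : cauchy (m @ \oo).
  apply/cauchy_rnormP => e e0.
  have [N _ HN] : \forall N \near \oo, 4 * N.+1%:R^-1 < e ^+ 2.
    have e40 : 0 < e ^+ 2 / 4 by rewrite divr_gt0// exprn_gt0.
    near=> N; rewrite mulrC -ltr_pdivlMr//; near: N.
    exact: near_infty_natSinv_lt (PosNum e40).
  exists (m N); exists N => // n /= Nn.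
  rewrite -(@ltr_pXn2r _ 2) ?nnegrE ?rnorm_ge0 ?(ltW e0)//.
  exact: le_lt_trans (mm _ _ Nn) (HN N (leqnn N)).
move=> /cauchy_cvg/cvg_ex[l /cvg_rnormP ml].
by exists l.
Unshelve. all: by end_near.
Qed.

Lemma nearest_point S x : lin_subspace S -> exists2 m, closure S m &
  forall s, S s -> rnorm (x - m) <= rnorm (x - s).
Proof.
move=> SS.
pose D := [set rnorm (x - s) ^+ 2 | s in S].
have infD : has_inf D.
  split; first by exists (rnorm (x - 0) ^+ 2); exists 0 => //; case: SS.
  by exists 0 => _ [s _ <-]; exact: sqr_ge0.
have dS s : S s -> inf D <= rnorm (x - s) ^+ 2.
  by move=> Ss; apply: ge_inf; [case: infD | exists s].
have /choice[m mP] n : exists s, S s /\ rnorm (x - s) ^+ 2 < inf D + n.+1%:R^-1.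
  have n0 : 0 < n.+1%:R^-1 :> R by rewrite invr_gt0.
  have [_ [s Ss <-] ?] := inf_adherent n0 infD.
  by exists s.
have [l lP] := minimizing_sequence_cvg SS (fun n => (mP n).1) dS (fun n => (mP n).2).
exists l.
  apply/closure_normP => e /lP/filter_ex[n ln].
  by exists (m n) => //; case: (mP n).
(* If some [s] were at distance [b] smaller than [g = |x - l|], a late [m n] would be within
   [(g-b)/2] of [l] and, being almost minimizing, within [(g+b)/2] of [x]. The triangle inequality
   would then give [g < g]. *)
move=> s Ss; rewrite leNgt; apply/negP => sl.
set b := rnorm (x - s) in sl *; set g := rnorm (x - l) in sl *.
have b0 : 0 <= b by exact: rnorm_ge0.
have e0 : 0 < (g - b) / 2 by rewrite divr_gt0// subr_gt0.
have f0 : 0 < ((g + b) / 2) ^+ 2 - b ^+ 2 by nra.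
have [n [/= ln nb]] : exists n, rnorm (l - m n) < (g - b) / 2 /\
    n.+1%:R^-1 < ((g + b) / 2) ^+ 2 - b ^+ 2.
  have [n []] := filter_ex (filterI (lP _ e0) (near_infty_natSinv_lt (PosNum f0))).
  by exists n.
have [_ /= mn] := mP n.
have xm : rnorm (x - m n) < (g + b) / 2.
  rewrite -(@ltr_pXn2r _ 2) ?nnegrE ?rnorm_ge0//; last by lra.
  by have := dS _ Ss; rewrite -/b; move: n.+1%:R^-1 nb mn => q nb mn bb; lra.
have := ler_rnormD (x - m n) (m n - l).
rewrite subrKA -(rnormN (m n - l)) opprB -/g; lra.
Qed.

Lemma orthogonal_projection S x : lin_subspace S -> exists2 m, closure S m &
  forall s, S s -> inner (x - m) s = 0.
Proof.
move=> SS; have [m Sm mx] := nearest_point x SS; exists m => //.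
(* Since [m] is only in the closure, [m + s] need not lie in [S]; it is approached by [m' + s] with
   [m'] in [S]. *)
have lem s : S s -> rnorm (x - m) <= rnorm (x - m - s).
  move=> Ss; apply/ler_addgt0Pr => e e0.
  move/closure_normP : Sm => /(_ _ e0)[m' Sm' mm'].
  apply: le_trans (mx (m' + s) (subspaceD SS Sm' Ss)) _.
  have -> : x - (m' + s) = (x - m - s) + (m - m').
    by rewrite [RHS]addrAC subrKA opprD addrA.
  by apply: le_trans (ler_rnormD _ _) _; rewrite lerD2l ltW.
have Re0 s : S s -> complex.Re (inner (x - m) s) = 0.
  move=> Ss; set r := complex.Re _.
  have q t : 0 <= t ^+ 2 * rnorm s ^+ 2 - 2 * (t * r).
    have := lem _ (subspaceZ (t%:C%C) SS Ss).
    rewrite -(@ler_pXn2r _ 2) ?nnegrE ?rnorm_ge0// (rnorm_sqrD (x - m)) innerNr rnormN.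
    rewrite rnormZr.
    have -> : complex.Re (- inner (x - m) (t%:C%C *: s)) = - (t * r).
      by rewrite /r -Re_innerZr; case: (inner _ (_ *: s)).
    by lra.
  (* At [t = r/k] the quadratic equals [- r^2 (k+1)/k^2], which is nonnegative only if [r = 0]. The
     added 1 keeps [k] positive when [s = 0]. *)
  pose k := rnorm s ^+ 2 + 1.
  have k0 : 0 < k by rewrite ltr_wpDl// sqr_ge0.
  have k1 : 0 < k + 1 by exact: addr_gt0.
  have /(_ (r / k)) := q.
  have -> : (r / k) ^+ 2 * rnorm s ^+ 2 - 2 * (r / k * r) =
     - (r ^+ 2 * (k + 1) / k ^+ 2).
    by rewrite /k; field; rewrite -/k gt_eqF.
  rewrite oppr_ge0 pmulr_lle0 ?invr_gt0 ?exprn_gt0// pmulr_lle0//.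
  by move=> r0; apply/eqP; rewrite -sqrf_eq0 eq_le r0 sqr_ge0.
(* Replacing [s] by [i s] turns the vanishing real part into a vanishing imaginary part. *)
move=> s Ss; have := Re0 _ (subspaceZ 'i%C SS Ss).
have := Re0 _ Ss; rewrite innerZr; case: (inner _ s) => u v /= -> .
by rewrite mulr0 mulN1r sub0r opprK => ->.
Qed.

End projection.

(** * Double orthogonal complements, Riesz representation and adjoints *)

Section adjoint.
Context (R : realType).
Implicit Types V W : hilbertType R.

Lemma inner_closure V (S : set V) x z :
  (forall s, S s -> inner s z = 0) -> closure S x -> inner x z = 0.
Proof.
move=> Sz /closure_normP Sx; apply: rnorm_eq0.
apply/eqP; rewrite eq_le rnorm_ge0 andbT; apply/ler_addgt0Pr => e e0.
have k0 : 0 < rnorm z + 1 by rewrite ltr_wpDl ?rnorm_ge0.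
have [|s Ss xs] := Sx (e / (rnorm z + 1)); first exact: divr_gt0.
rewrite add0r -(subr0 (inner x z)) -(Sz s Ss) -innerBl.
apply: le_trans (rnorm_inner_le _ _) _.
apply: (@le_trans _ _ (rnorm (x - s) * (rnorm z + 1))).
  by rewrite ler_wpM2l ?rnorm_ge0// lerDl.
by rewrite -ler_pdivlMr// ltW.
Qed.

(** For the converse, let [m] be the projection of [x]. The remainder [x - m] is orthogonal to [S],
    hence to [x] by hypothesis and to [m] by continuity, so it is orthogonal to itself. *)
Lemma closure_perpP V (S : set V) x : lin_subspace S ->
  closure S x <-> forall z, (forall s, S s -> inner s z = 0) -> inner x z = 0.
Proof.
move=> SS; split=> [Sx z Sz|xS]; first exact: inner_closure Sz Sx.
have [m Sm mx] := orthogonal_projection x SS.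
have Sz s : S s -> inner s (x - m) = 0 by move=> Ss; rewrite innerC mx ?conjC0.
have : inner (x - m) (x - m) = 0.
  by rewrite innerBl xS// (inner_closure Sz Sm) subr0.
by move/inner_eq0/eqP; rewrite subr_eq0 => /eqP ->.
Qed.

(** When [f] is nonzero, the component [n] of some [x0] outside the kernel that is orthogonal to the
    kernel represents [f] up to a scalar. *)
Lemma riesz V (f : V -> R[i]) (M : R) : scalar f ->
  (forall x, rnorm (f x : R[i]) <= M * rnorm x) ->
  exists y, forall x, f x = inner x y.
Proof.
move=> fl fM.
have f0 : f 0 = 0 by have := fl (-1) 0 0; rewrite scaler0 addr0 mulN1r addNr.
have fB x y : f (x - y) = f x - f y.
  by rewrite addrC -scaleN1r fl mulN1r addrC.
have fZ a x : f (a *: x) = a * f x by rewrite -[a *: x]addr0 fl f0 addr0.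
have [x0|/existsNP[x0 /eqP fx0]] := pselect (forall x, f x = 0).
  by exists 0 => x; rewrite inner0r.
pose S := [set x | f x = 0].
have SS : lin_subspace S.
  by split=> //= a x y; rewrite /S /= fl => -> ->; rewrite mulr0 addr0.
have [m Sm mx] := orthogonal_projection x0 SS.
(* The bound on [f] makes its kernel closed, so the limit point [m] stays in it. *)
have fm : f m = 0.
  apply: rnorm_eq0.
  apply/eqP; rewrite eq_le rnorm_ge0 andbT; apply/ler_addgt0Pr => e e0.
  have k0 : 0 < `|M| + 1 by rewrite ltr_wpDl.
  move/closure_normP : Sm => /(_ (e / (`|M| + 1)))[|s Ss ms].
    exact: divr_gt0.
  rewrite add0r -(subr0 (f m)) -Ss -fB; apply: le_trans (fM _) _.
  apply: (@le_trans _ _ (rnorm (m - s) * (`|M| + 1))).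
    by rewrite mulrC ler_wpM2l ?rnorm_ge0// (le_trans (ler_norm M))// lerDl.
  by rewrite -ler_pdivlMr// ltW.
set n := x0 - m in mx.
have fn : f n = f x0 by rewrite fB fm subr0.
have nn : inner n n != 0.
  by apply: contra fx0 => /eqP/inner_eq0 n0; rewrite -fn n0 f0.
exists ((f x0 / inner n n)^*%R *: n) => x.
(* Subtracting this multiple of [n] from [x] lands in the kernel, so orthogonality to [n] expresses
   [<x,n>] through [f x]. *)
have /mx : S (x - (f x / f x0) *: n) by rewrite /S /= fB fZ fn divfK ?subrr.
rewrite innerBr innerZr innerC => /eqP.
rewrite subr_eq0 => /eqP nx.
rewrite innerZr conjCK -(conjCK (inner x n)) nx rmorphM /= !conjCK -innerC.
by rewrite mulrA; field; rewrite nn fx0.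
Qed.

(** Riesz is applied to [x |-> <T x, y>] for each [y]; uniqueness of the representing vector gives
    linearity, and [|S y|^2 = <T (S y), y>] gives the bound. [T] is a plain map because [dilU] comes
    as one. *)
Lemma exists_adjoint V W (T : V -> W) (M : R) : linear T ->
  (forall x, rnorm (T x) <= M * rnorm x) ->
  exists S : boundedOp W V, is_adjoint T S.
Proof.
move=> Tl TM.
have /choice[S SP] y : exists z, forall x, inner (T x) y = inner x z.
  apply: (@riesz _ _ (M * rnorm y)) => [a u v|x].
    by rewrite Tl inner_linearl.
  apply: le_trans (rnorm_inner_le _ _) _.
  by rewrite mulrAC ler_wpM2r ?rnorm_ge0.
have Sl : linear S.
  move=> a u v; apply: inner_inj => x.
  by rewrite -SP !innerDr !innerZr !SP.
pose SL : {linear W -> V} := HB.pack S (GRing.isLinear.Build _ _ _ _ S Sl).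
have Sc : continuous SL.
  (* The sign of [M] is unknown when the space is zero, hence the absolute value. *)
  apply: (@bounded_ofP _ _ _ _ `|M|) => y /=.
  have [->|y0] := eqVneq (rnorm (S y)) 0; first by rewrite mulr_ge0 ?rnorm_ge0.
  have yp : 0 < rnorm (S y) by rewrite lt_neqAle eq_sym y0 rnorm_ge0.
  rewrite -(ler_pM2r yp) -expr2 -Re_inner_xx -SP.
  apply: le_trans (Re_inner_le _ _) _.
  rewrite mulrAC ler_wpM2r ?rnorm_ge0// (le_trans (TM _))//.
  by rewrite ler_wpM2r ?rnorm_ge0// ler_norm.
pose SB : boundedOp W V := HB.pack S (GRing.isLinear.Build _ _ _ _ S Sl)
  (isContinuous.Build _ _ S Sc).
by exists SB.
Qed.

(** Linearity and the bound rule out the default branch in the definition of [adj]. *)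
Lemma adjP V W (T : V -> W) (M : R) : linear T ->
  (forall x, rnorm (T x) <= M * rnorm x) -> is_adjoint T (adj T).
Proof.
move=> Tl TM; rewrite /adj; case: pselect => [e|]; first exact: svalP (cid e).
by have := exists_adjoint Tl TM.
Qed.

Lemma adj_op V W (T : boundedOp V W) : is_adjoint T (adj T).
Proof.
have [M _ TM] := boundedOpP T; apply: adjP TM; exact: linearP.
Qed.

End adjoint.

(** * Defect operators and the action of [P^*] on defect spaces *)

Section defect.
Context (R : realType) (H : hilbertType R).
Implicit Types (P D : boundedOp H H).

(** Polarization: the quadratic form is real at [x + y] and at [x + i y], which settles the
    imaginary and the real part respectively. *)
Lemma ge0_selfadjoint D : (forall x, 0 <= inner (D x) x) -> is_adjoint D D.
Proof.
move=> D0; have ImD x : complex.Im (inner (D x) x) = 0.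
  by have := D0 x; case: (inner _ _) => a b; rewrite lecE /= => /andP[/eqP].
move=> x y; rewrite [RHS]innerC.
have := ImD (x + y); have := ImD (x + 'i%C *: y); move: (ImD x) (ImD y).
rewrite !linearD !linearZ /= !(innerDl, innerDr, innerZl, innerZr).
case: (inner (D x) x) (inner (D y) y) (inner (D x) y) (inner (D y) x)
  => [a b] [a' b'] [c d] [c' d'] /= -> ->.
by move=> h1 h2; congr Complex; lra.
Qed.

Lemma range_lin_subspace D : lin_subspace (range D).
Proof.
split; first by exists 0; rewrite ?linear0.
by move=> a _ _ [x _ <-] [y _ <-]; exists (a *: x + y); rewrite ?linearP.
Qed.

Lemma closure_range_perpP D x : is_adjoint D D ->
  closure (range D) x <-> forall z, D z = 0 -> inner x z = 0.
Proof.
move=> DD; rewrite (closure_perpP _ (range_lin_subspace D)).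
split=> [xD z Dz|xD z Dz]; apply: xD.
  by move=> _ [y _ <-]; rewrite DD Dz inner0r.
by apply: inner_inj => y; rewrite -DD inner0r Dz//; exists y.
Qed.

Lemma adjK P : adj (adj P) =1 P.
Proof.
move=> x; apply: inner_inj => y.
by rewrite -adj_op innerC -adj_op -innerC.
Qed.

(** By duality it suffices that [P] maps the kernel of [DP] into that of [DPs]. If [DP z = 0] then
    [P^* P z = z], so [DPs^2 (P z) = P z - P P^* P z = 0], and self-adjointness gives
    [DPs (P z) = 0]. *)
Lemma adj_defect_clran P DP DPs x : is_defect_op P DP ->
  is_defect_op (adj P) DPs -> x \in in_clran DPs -> adj P x \in in_clran DP.
Proof.
move=> [DP0 DPE] [DPs0 DPsE] /in_clranP.
move/(closure_range_perpP _ (ge0_selfadjoint DPs0)) => xD.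
apply/in_clranP/closure_range_perpP; first exact: ge0_selfadjoint.
move=> z Dz; rewrite innerC -adj_op -innerC; apply: xD.
have zP : adj P (P z) = z.
  by have := DPE z; rewrite Dz linear0 => /esym/eqP; rewrite subr_eq0 => /eqP.
apply: inner_eq0; rewrite -(ge0_selfadjoint DPs0) DPsE adjK zP subrr.
by rewrite inner0l.
Qed.

End defect.

(** * Head, tail and coordinate vectors of square-summable sequences *)

Section l2_inner.
Context (R : realType) (E : hilbertType R).
Implicit Types (a b : l2 E) (x : E).

Lemma l2_eqP a b : a =1 b -> a = b.
Proof. by move=> ab; apply/val_inj/funext. Qed.

Lemma lim_series_recl (u : nat -> R) : cvgn (series u) ->
  limn (series u) = u 0%N + limn (series (fun n => u n.+1)).
Proof.
move=> uc.
have E1 : (fun n => series u n.+1) = (fun n => u 0%N + series (fun n => u n.+1) n).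
  by apply/funext => n; rewrite /series/= big_nat_recl.
have u'c : (fun n => u 0%N + series (fun n => u n.+1) n) @ \oo --> limn (series u).
  by rewrite -E1; have := uc; rewrite -(cvg_shiftS (series u)).
apply/eqP; rewrite addrC -subr_eq; apply/eqP/esym/cvg_lim => //.
rewrite (_ : series _ = fun n => (u 0%N + series (fun n => u n.+1) n) - u 0%N).
  by apply: cvgB u'c _; exact: cvg_cst.
by apply/funext => n; rewrite addrAC subrr add0r.
Qed.

Lemma csum_recl (z : nat -> R[i]) : csummable z ->
  csum z = z 0%N + csum (fun n => z n.+1).
Proof.
move=> zs; rewrite /csum.
rewrite (lim_series_recl (csummable_Re zs)) (lim_series_recl (csummable_Im zs)).
by case: (z 0%N).
Qed.

(** This presents [l2 E] as the orthogonal sum of [E] and [l2 E], so later facts about shifts need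
    only induction and no further series. *)
Lemma l2_inner_recl a b :
  inner a b = inner (a 0%N) (b 0%N) + inner (l2_tail a) (l2_tail b).
Proof. by rewrite [LHS](csum_recl (@l2_inner_summable _ _ a b)). Qed.

Lemma l2_tail_cons x a : l2_tail (l2_cons x a) = a.
Proof. exact: l2_eqP. Qed.

Lemma l2_cons_tail a : l2_cons (a 0%N) (l2_tail a) = a.
Proof. by apply: l2_eqP => -[]. Qed.

Lemma l2_cons00 : l2_cons (0 : E) 0 = 0.
Proof. by apply: l2_eqP => -[]. Qed.

Lemma l2_consP (c : R[i]) x y a b :
  l2_cons (c *: x + y) (c *: a + b) = c *: l2_cons x a + l2_cons y b.
Proof. by apply: l2_eqP => -[]. Qed.

Lemma rnorm_l2_cons x a : rnorm (l2_cons x a) ^+ 2 = rnorm x ^+ 2 + rnorm a ^+ 2.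
Proof. by rewrite -!Re_inner_xx l2_inner_recl l2_tail_cons ReD. Qed.

Lemma rnorm_l2_cons_le x a : rnorm (l2_cons x a) <= rnorm x + rnorm a.
Proof.
rewrite -(@ler_pXn2r _ 2) ?nnegrE ?addr_ge0 ?rnorm_ge0// rnorm_l2_cons.
by have := mulr_ge0 (rnorm_ge0 x) (rnorm_ge0 a); nra.
Qed.

Lemma rnorm_l2_head a : rnorm (a 0%N) <= rnorm a.
Proof.
rewrite -(@ler_pXn2r _ 2) ?nnegrE ?rnorm_ge0//.
by rewrite -{2}(l2_cons_tail a) rnorm_l2_cons lerDl sqr_ge0.
Qed.

Lemma rnorm_l2_tail a : rnorm (l2_tail a) <= rnorm a.
Proof.
rewrite -(@ler_pXn2r _ 2) ?nnegrE ?rnorm_ge0//.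
by rewrite -{2}(l2_cons_tail a) rnorm_l2_cons lerDr sqr_ge0.
Qed.

(** Written as an iterated shift to match the iterates of [U] and of its adjoint. *)
Definition l2_delta k x : l2 E := iter k (l2_cons 0) (l2_cons x 0).

Lemma inner_l2_delta k x a : inner (l2_delta k x) a = inner x (a k).
Proof.
elim: k a => [|k IH] a /=; rewrite l2_inner_recl l2_tail_cons /=.
  by rewrite inner0l addr0.
by rewrite inner0l add0r IH.
Qed.

End l2_inner.

(** * Inner products and norms on direct sums *)

Section dsum_norm.
Context (R : realType) (V W : hilbertType R).
Implicit Types x y : dsum V W.

Lemma inner_dsum x y : inner x y = inner x.1 y.1 + inner x.2 y.2.
Proof. by []. Qed.

Lemma inner_dsum0l w x : inner ((0, w) : dsum V W) x = inner w x.2.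
Proof. by rewrite inner_dsum /= inner0l add0r. Qed.

Lemma inner_dsum0r v x : inner ((v, 0) : dsum V W) x = inner v x.1.
Proof. by rewrite inner_dsum /= inner0l addr0. Qed.

Lemma rnorm_dsum_le x : rnorm x <= rnorm x.1 + rnorm x.2.
Proof.
rewrite -(@ler_pXn2r _ 2) ?nnegrE ?addr_ge0 ?rnorm_ge0// rnorm_dsum.
by have := mulr_ge0 (rnorm_ge0 x.1) (rnorm_ge0 x.2); nra.
Qed.

Lemma rnorm_fst x : rnorm x.1 <= rnorm x.
Proof.
by rewrite -(@ler_pXn2r _ 2) ?nnegrE ?rnorm_ge0// rnorm_dsum lerDl sqr_ge0.
Qed.

Lemma rnorm_snd x : rnorm x.2 <= rnorm x.
Proof.
by rewrite -(@ler_pXn2r _ 2) ?nnegrE ?rnorm_ge0// rnorm_dsum lerDr sqr_ge0.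
Qed.

End dsum_norm.

(** * Linear spans and a density criterion *)

Section lspan.
Context (K : pzRingType) (V : lmodType K).
Implicit Types (S : set V).

Lemma lspan_gen S x : S x -> lspan S x.
Proof.
by move=> Sx; exists 1%N, (fun=> 1), (fun=> x); split=> //;
  rewrite big_ord1 scale1r.
Qed.

Lemma lspanP S (a : K) x y : lspan S x -> lspan S y -> lspan S (a *: x + y).
Proof.
move=> [n [c [v [Sv ->]]]] [m [d [w [Sw ->]]]].
exists (n + m)%N.
exists (fun i => match fintype.split i with inl j => a * c j | inr j => d j end).
exists (fun i => match fintype.split i with inl j => v j | inr j => w j end).
split=> [i|]; first by case: (fintype.split i).
rewrite big_split_ord /= scaler_sumr; congr (_ + _); apply: eq_bigr => i _.
  by rewrite (unsplitK (inl i)) scalerA.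
by rewrite (unsplitK (inr i)).
Qed.

Lemma lspan0 S : lspan S 0.
Proof. by exists 0%N, (fun=> 0), (fun=> 0); split; [case|rewrite big_ord0]. Qed.

End lspan.

Lemma closure_lspanT (R : realType) (V : hilbertType R) (S : set V) :
  (forall z, (forall s, S s -> inner s z = 0) -> z = 0) ->
  closure (lspan S) = setT.
Proof.
move=> S0; have lS : lin_subspace (lspan S).
  by split=> [|a x y]; [exact: lspan0 | exact: lspanP].
apply/seteqP; split=> // x _; apply/closure_perpP => // z Sz.
suff -> : z = 0 by rewrite inner0r.
by apply: S0 => s Ss; apply/Sz/lspan_gen.
Qed.

(* In a statement about [dsum V W] the module structure is inferred directly, not
   through the Hilbert structure; the two are convertible, but comparing them at
   concrete [V] and [W] is very slow. *)
Lemma closure_lspan_dsumT (R : realType) (V W : hilbertType R)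
    (S : set (dsum V W)) :
  (forall z, (forall s, S s -> inner s z = 0) -> z = 0) ->
  closure (lspan S) = setT.
Proof. exact: (@closure_lspanT R (dsum V W)). Qed.

(** * The operator [U], its adjoint, and the orbits of [H] under both *)

Section schaffer.
Context (R : realType) (H : hilbertType R) (P DP DPs : boundedOp H H).
Hypotheses (hDP : is_defect_op P DP) (hDPs : is_defect_op (adj P) DPs).
Local Notation cDP := (clran DP).
Local Notation cDPs := (clran DPs).
Local Notation Ht := (dsum H (l2 cDP)).
Local Notation K := (dsum Ht (l2 cDPs)).
Local Notation U := (dilU P DP DPs).
Local Notation W := (@adjP_defect R H P DP DPs).

(** The default of [insubd] is never reached, since [P^*] maps one defect space into the other. *)
Lemma val_adjP_defect (x : cDPs) : val (W x) = adj P (val x).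
Proof. by rewrite /adjP_defect insubdK//; exact: adj_defect_clran (valP x). Qed.

Lemma adjP_defect_linear : linear W.
Proof.
move=> a x y; apply: val_inj.
rewrite [RHS](_ : _ = a *: val (W x) + val (W y))// !val_adjP_defect.
by rewrite -linearP.
Qed.

Lemma to_clran_linear : linear (to_clran DP).
Proof. by move=> a x y; apply: val_inj; rewrite /= linearP. Qed.

Lemma dilU_linear : linear U.
Proof.
move=> a [[h u] v] [[h' u'] v'].
rewrite /dilU /block_triangular /dilV3 /dilC3 /=.
have -> : l2_tail (a *: v + v') = a *: l2_tail v + l2_tail v' by exact: l2_eqP.
congr (_, _).
have -> : - W ((a *: v + v') 0%N) = a *: (- W (v 0%N)) + (- W (v' 0%N)).
  by rewrite (_ : _ 0%N = a *: v 0%N + v' 0%N)// adjP_defect_linear opprD scalerN.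
have -> : to_clran DP (a *: h + h') = a *: to_clran DP h + to_clran DP h'.
  exact: to_clran_linear.
congr (_, _) => /=.
  by rewrite !linearP /= scalerDr addrACA.
rewrite !l2_consP.
have -> : l2_cons (a *: (- W (v 0%N)) + (- W (v' 0%N))) 0 =
   a *: l2_cons (- W (v 0%N)) 0 + l2_cons (- W (v' 0%N)) 0.
  by rewrite -l2_consP scaler0 addr0.
by rewrite scalerDr addrACA.
Qed.

Lemma dilU_bounded : exists M : R, forall x, rnorm (U x) <= M * rnorm x.
Proof.
have [Mp Mp0 Pb] := boundedOpP P.
have [Md Md0 Db] := boundedOpP DP.
have [Ms Ms0 Sb] := boundedOpP DPs.
have [Ma Ma0 Ab] := boundedOpP (adj P).
(* One summand per entry of [U x]; the 2 counts the shifted [x.1.2] and the tail of [x.2], both of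
   norm at most that of [x]. *)
exists (Mp + Md + Ms + Ma + 2) => x.
have x11 : rnorm x.1.1 <= rnorm x := le_trans (rnorm_fst x.1) (rnorm_fst x).
have x12 : rnorm x.1.2 <= rnorm x := le_trans (rnorm_snd x.1) (rnorm_fst x).
have x20 : rnorm (x.2 0%N) <= rnorm x := le_trans (rnorm_l2_head x.2) (rnorm_snd x).
have x2t : rnorm (l2_tail x.2) <= rnorm x := le_trans (rnorm_l2_tail x.2) (rnorm_snd x).
have bnd M u : 0 <= M -> u <= rnorm x -> M * u <= M * rnorm x.
  by move=> M0 ?; rewrite ler_wpM2l.
apply: le_trans (rnorm_dsum_le _) _ => /=.
apply: le_trans (lerD (ler_rnormD _ _) (lexx _)) _.
apply: le_trans (lerD (lerD (rnorm_dsum_le _) (rnorm_dsum_le _)) (lexx _)) _ => /=.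
have h1 := rnorm_l2_cons_le (to_clran DP x.1.1) x.1.2.
have h2 := rnorm_l2_cons_le (- W (x.2 0%N)) 0.
have h3 := le_trans (Pb x.1.1) (bnd _ _ Mp0 x11).
have h4 := le_trans (Db x.1.1) (bnd _ _ Md0 x11).
have h5 : rnorm (DPs (val (x.2 0%N))) <= Ms * rnorm x.
  by apply: le_trans (Sb _) _; apply: bnd => //; rewrite -rnorm_clran.
have h6 : rnorm (W (x.2 0%N)) <= Ma * rnorm x.
  rewrite rnorm_clran val_adjP_defect; apply: le_trans (Ab _) _.
  by apply: bnd => //; rewrite -rnorm_clran.
move: h1 h2; rewrite rnormN rnorm0 (rnorm_clran (to_clran _ _)) /= => h1 h2.
lra.
Qed.

Lemma adj_dilU : is_adjoint U (adj U).
Proof. have [M UM] := dilU_bounded; exact: adjP dilU_linear UM. Qed.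

(** Pairing with [U x] sees only its first and last components, where [D_{P*}] is self-adjoint and
    the tail map is dual to the right shift. Vectors with zero middle component are thus preserved,
    so orbits of [H] under the adjoint stay among them. *)
Lemma adj_dilUE h b : adj U (((h, 0), b) : K) =
  (((adj P h, 0), l2_cons (to_clran DPs h) b) : K).
Proof.
apply: inner_inj => -[[h' a'] b']; rewrite -adj_dilU.
rewrite !inner_dsum /= !inner0r !addr0 innerDl -adj_op -addrA; congr (_ + _).
rewrite [RHS]l2_inner_recl l2_tail_cons; congr (_ + _).
by apply: ge0_selfadjoint; case: hDPs.
Qed.

Lemma iter_dilUB k x y : iter k U (x - y) = iter k U x - iter k U y.
Proof.
elim: k => //= k ->.
by rewrite addrC -scaleN1r dilU_linear scaleN1r addrC.
Qed.

(** For [k = 0] the components in [H] cancel and [D_P h] remains at coordinate 0. On vectors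
    supported in [l2(D_P)] the operator [U] is the unilateral shift, which carries the entry to
    coordinate [k]. *)
Lemma iter_dilU_delta k h :
  iter k U (U (dil_embed DP DPs h)) - iter k U (dil_embed DP DPs (P h)) =
  (((0, l2_delta k (to_clran DP h)), 0) : K).
Proof.
rewrite -iter_dilUB.
have W0 : W 0 = 0 by apply: val_inj; rewrite val_adjP_defect !linear0.
have tail0 : l2_tail (0 : l2 cDPs) = 0 by exact: l2_eqP.
elim: k => [|k /= ->] /=; rewrite /dilU /block_triangular /dilV3 /dilC3 /=.
  rewrite tail0 /= W0 oppr0 l2_cons00 !linear0.
  by congr ((_, _), _); rewrite ?addr0 ?subrr ?subr0.
rewrite tail0 W0 oppr0 l2_cons00 !linear0.
have -> : to_clran DP 0 = 0 by apply: val_inj; rewrite /= !linear0.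
by rewrite addr0.
Qed.

Lemma adj_dilUB x y : adj U (x - y) = adj U x - adj U y.
Proof. exact: linearB. Qed.

Lemma adj_dilU_shift b : adj U (((0, 0), b) : K) = (((0, 0), l2_cons 0 b) : K).
Proof.
rewrite adj_dilUE linear0.
by have -> : to_clran DPs 0 = 0 by apply: val_inj; rewrite /= linear0.
Qed.

Lemma iter_adj_dilU_delta k h :
  iter k (adj U) (adj U (dil_embed DP DPs h)) -
    iter k (adj U) (dil_embed DP DPs (adj P h)) =
  (((0, 0), l2_delta k (to_clran DPs h)) : K).
Proof.
elim: k => [|k IH].
  by rewrite /= /dil_embed adj_dilUE; congr ((_, _), _); rewrite ?subrr ?subr0.
by rewrite /= -adj_dilUB IH; exact: adj_dilU_shift.
Qed.

Lemma dilU_total_perp (z : K) :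
  (forall k h, inner (iter k U (dil_embed DP DPs h)) z = 0) ->
  (forall k h, inner (iter k (adj U) (dil_embed DP DPs h)) z = 0) -> z = 0.
Proof.
move=> Uz Vz.
(* The vectors [D h] are dense in [clran D], so a member orthogonal to all of them is orthogonal to
   itself. *)
have perp0 D (x : clran D) : is_adjoint D D ->
    (forall h : H, inner (to_clran D h) x = 0) -> x = 0.
  move=> DD Dx; apply/inner_eq0.
  apply: (@inner_closure _ _ (range D)); last exact/in_clranP/valP.
  by move=> _ [h _ <-]; exact: Dx.
have z11 : z.1.1 = 0.
  apply: inner_eq0; have := Uz 0%N z.1.1.
  by rewrite /dil_embed /= !inner_dsum0r.
have z12 : z.1.2 = 0.
  apply: l2_eqP => k; apply: perp0; first by apply: ge0_selfadjoint; case: hDP.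
  (* The [k]-th coordinate is read off by pairing with a coordinate vector, which is a difference of
     two orbit vectors orthogonal to [z]. *)
  move=> g; rewrite -inner_l2_delta -inner_dsum0l -inner_dsum0r.
  by rewrite -iter_dilU_delta innerBl -iterSr !Uz subrr.
have z2 : z.2 = 0.
  apply: l2_eqP => k; apply: perp0; first by apply: ge0_selfadjoint; case: hDPs.
  move=> g; rewrite -inner_l2_delta -inner_dsum0l.
  by rewrite -iter_adj_dilU_delta innerBl -iterSr !Vz subrr.
by case: z z11 z12 z2 {Uz Vz} => [[h a] b] /= -> -> ->.
Qed.

End schaffer.

Theorem mainTheorem3 (R : realType) (H : hilbertType R)
    (A B P DP DPs : boundedOp H H)
    (F1 F2 : boundedOp (clran DP) (clran DP))
    (G1 G2 : boundedOp (clran DPs) (clran DPs))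
    (hABP : tetrablock_contraction A B P)
    (hDP : is_defect_op P DP)
    (hDPs : is_defect_op (adj P) DPs)
    (hF : fundamental_ops A B P F1 F2)
    (hG : fundamental_ops (adj A) (adj B) (adj P) G1 G2)
    (hF12 : commutator F1 F2 =1 \0)
    (hFF : commutator F1 (adj F1) =1 commutator F2 (adj F2)) :
  let R1 := dilR1 A P F1 F2 G1 G2 in
  let R2 := dilR2 B P F1 F2 G1 G2 in
  let U := dilU P DP DPs in
  closure (lspan [set y | exists (h : H) (k1 k2 k3 l1 l2 l3 : nat),
    y = iter k1 R1 (iter k2 R2 (iter k3 U
          (iter l1 (adj R1) (iter l2 (adj R2) (iter l3 (adj U)
             (dil_embed DP DPs h))))))]) = setT.
Proof.
(* A vector orthogonal to all words is in particular orthogonal to the pure powers of [U] and of its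
   adjoint, obtained by setting the remaining exponents to 0. *)
move=> R1 R2 U; apply: closure_lspan_dsumT => z Gz.
apply: (dilU_total_perp hDP hDPs) => k h; apply: Gz.
  by exists h, 0%N, 0%N, k, 0%N, 0%N, 0%N.
by exists h, 0%N, 0%N, 0%N, 0%N, 0%N, k.
Qed.
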